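(* Let $n\in\mathbb N$ be standard and let $\mathcal A=(\alpha_{ij})_{n\times n}\in\mathcal M_n(\mathbb E)$ be a non-singular matrix. Assume that (1) $\overline\alpha$ is zeroless, and (2) $R(\mathcal A)=\det(\mathcal A)/\overline{\alpha}^{\,n}$ is not an absorber of $\overline A$. Then $\mathcal A$ is invertible with respect to $\dfrac{\overline A}{\overline\alpha}$, and $\dfrac{1}{\det(\mathcal A)}\mathcal C^T$ is an inverse matrix of $\mathcal A$ with respect to $\dfrac{\overline A}{\overline\alpha}$, where $\mathcal C$ is the cofactor matrix of $\mathcal A$.
   Context: We work in nonstandard analysis with external sets (the theory HST of Kanovei and Reeken, extending a bounded form of Nelson's IST), so $\mathbb R$ contains nonstandard numbers; a real is limited if it is bounded in absolute value by a standard natural number, and infinitesimal if it is $0$ or the reciprocal of an unlimited number. A neutrix is a convex additive subgroup of $\mathbb R$ (possibly an external set), e.g. $\oslash$, the set of all infinitesimals. Neutrices are ordered by inclusion (so max, min of neutrices are with respect to inclusion). An external number is a set $\alpha=a+A=\{a+x: x\in A\}$ with $a\in\mathbb R$ (a representative) and $A=N(\alpha)$ a neutrix (the neutrix part); $\mathbb E$ is the class of external numbers, and $a$ is identified with $a+\{0\}$. $\alpha$ is zeroless if $0\notin\alpha$; otherwise $\alpha$ is a neutrix. Operations are Minkowski operations: $(a+A)\pm(b+B)=(a\pm b)+(A+B)$, $(a+A)(b+B)=ab+aB+bA+AB$, and for zeroless $\alpha=a+A$, $1/\alpha=1/a+A/a^2$. Order: $\alpha\le\beta$ iff $\forall a\in\alpha\,\exists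 b\in\beta\,(a\le b)$; $|\alpha|=\alpha$ if $0\le\alpha$ and $|\alpha|=-\alpha$ otherwise. $\mathcal M_n(\mathbb E)$ is the class of $n\times n$ matrices over $\mathbb E$, with products defined by the usual formulas; inclusion between matrices is entrywise. For $\mathcal A=(\alpha_{ij})$ with $\alpha_{ij}=a_{ij}+A_{ij}$, put $\overline A=\max_{i,j}A_{ij}$ and let $\overline\alpha$ denote the maximum of $|\alpha_{ij}|$ over all $i,j$ (signs are irrelevant in the statement). The determinant is $\det(\mathcal A)=\sum_{\sigma\in S_n}\operatorname{sgn}(\sigma)\alpha_{1\sigma(1)}\cdots\alpha_{n\sigma(n)}$; the cofactors are the signed $(n-1)\times(n-1)$ minors, as usual. $\mathcal A$ is non-singular if $\det(\mathcal A)$ is zeroless. An external number $\alpha$ is an absorber of a neutrix $N$ if $\alpha N\subsetneq N$. For a neutrix $N\subseteq\oslash$, $\mathcal I_n(N)$ is the matrix with diagonal entries $1+N$ and off-diagonal entries $N$. $\mathcal A$ is invertible with respect to $N$ if there is $\mathcal B\in\mathcal M_n(\mathbb E)$ with $\mathcal A\mathcal B\subseteq\mathcal I_n(N)$ and $\mathcal B\mathcal A\subseteq\mathcal I_n(N)$; such a $\mathcal B$ is called an inverse matrix of $\mathcal A$ with respect to $N$. (When $\overline\alpha$ is zeroless, $\overline A/\overline\alpha\subseteq\oslash$.) *)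

(* Defs.v *)
From HB Require Import structures.
From mathcomp Require Import all_boot all_order all_algebra all_fingroup.
From mathcomp Require Import boolp classical_sets.
From mathcomp Require Import ring lra.
Set Implicit Arguments.
Unset Strict Implicit.
Unset Printing Implicit Defensive.
Import Order.TTheory GRing.Theory Num.Theory.
Local Open Scope ring_scope.
Local Open Scope classical_set_scope.

(* The nonstandard real line is an ordered field R with unlimited elements,
   seen from the external universe: the standard natural numbers are the
   elements of nat, and external subsets of R are arbitrary elements of set R.
   The field of reals of HST, with its external subsets, is an instance. *)

Section Nonstandard.
Variable R : realFieldType.
Implicit Types (x y : R) (N M S : set R).

Definition limited x := exists n : nat, `|x| <= n%:R.

Definition infinitesimals : set R :=
  [set x | x = 0 \/ exists2 y, ~ limited y & x = y^-1].

Definition neutrix N :=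
  [/\ N 0, forall x y, N x -> N y -> N (x - y)
    & forall x y z, N x -> N y -> x <= z <= y -> N z].

Definition external S :=
  exists a, exists2 N, neutrix N & S = [set a + x | x in N].

End Nonstandard.

Definition nonstandard (R : realFieldType) := exists x : R, ~ limited x.

Record extnum (R : realFieldType) :=
  ExtNum { carrier : set R; carrierP : external carrier }.

HB.instance Definition _ (R : realFieldType) := gen_eqMixin (extnum R).
HB.instance Definition _ (R : realFieldType) := gen_choiceMixin (extnum R).

Section NeutrixTheory.
Variable R : realFieldType.
Implicit Types (a b x y : R) (N M S : set R).

Lemma neutrixN N x : neutrix N -> N x -> N (- x).
Proof. by case=> N0 NB _ Nx; rewrite -sub0r; apply: NB. Qed.

Lemma neutrixD N x y : neutrix N -> N x -> N y -> N (x + y).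
Proof.
move=> nN Nx Ny; have [_ NB _] := nN.
by rewrite -[y]opprK; apply: NB => //; apply: neutrixN.
Qed.

Lemma neutrix_le N x y : neutrix N -> N x -> `|y| <= `|x| -> N y.
Proof.
move=> nN Nx; have [_ _ NC] := nN.
have Nax : N `|x| by case: (ger0P x) => // _; apply: neutrixN.
rewrite ler_norml => yx; apply: (NC (- `|x|) `|x|) => //.
exact: neutrixN.
Qed.

Lemma neutrix_normP N : N 0 -> (forall x y, N x -> N y -> N (x + y)) ->
  (forall x y, N x -> `|y| <= `|x| -> N y) -> neutrix N.
Proof.
move=> N0 ND NC; split=> // [x y Nx Ny|x y z Nx Ny /andP[xz zy]].
  by apply: ND => //; apply: (NC y) => //; rewrite normrN.
have [xy|yx] := leP `|x| `|y|.
  apply: (NC y) => //; rewrite ler_norml; apply/andP; split.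
    have := ler_norm (- x); rewrite normrN; lra.
  exact: le_trans zy (ler_norm _).
apply: (NC x) => //; rewrite ler_norml; apply/andP; split.
  have := ler_norm (- x); rewrite normrN; lra.
by apply: le_trans zy _; apply: le_trans (ler_norm _) _; apply: ltW.
Qed.

Lemma neutrix_total N M : neutrix N -> neutrix M -> N `<=` M \/ M `<=` N.
Proof.
move=> nN nM; have [|NM] := pselect (N `<=` M); first by left.
right=> y My; have [x Nx nMx] : exists2 x, N x & ~ M x.
  by move/existsNP: NM => [x /not_implyP[Nx nMx]]; exists x.
have [xy|yx] := leP `|x| `|y|; first by case: nMx; apply: neutrix_le My xy.
by apply: neutrix_le Nx (ltW _).
Qed.

Lemma neutrix_lt N a x : neutrix N -> ~ N a -> N x -> `|x| < `|a|.
Proof.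
by move=> nN Na Nx; rewrite ltNge; apply/negP => ax; apply: Na; apply: neutrix_le ax.
Qed.

Lemma neutrix0 : neutrix [set (0 : R)].
Proof.
apply: neutrix_normP => //= [x y -> ->|x y -> ]; first by rewrite addr0.
by rewrite normr0 normr_le0 => /eqP.
Qed.

Lemma neutrix_add N M : neutrix N -> neutrix M ->
  neutrix [set x + y | x in N & y in M].
Proof.
move=> nN nM; have [N0 _ _] := nN; have [M0 _ _] := nM.
have [NM|MN] := neutrix_total nN nM.
  suff -> : [set x + y | x in N & y in M] = M by [].
  apply/seteqP; split=> [_ [x Nx [y My <-]]|y My].
    by apply: neutrixD => //; apply: NM.
  by exists 0 => //; exists y; rewrite ?add0r.
suff -> : [set x + y | x in N & y in M] = N by [].
apply/seteqP; split=> [_ [x Nx [y My <-]]|x Nx].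
  by apply: neutrixD => //; apply: MN.
by exists x => //; exists 0; rewrite ?addr0.
Qed.

Lemma neutrix_scale a N : neutrix N -> neutrix [set a * x | x in N].
Proof.
move=> nN; have [N0 _ _] := nN; apply: neutrix_normP.
- by exists 0; rewrite ?mulr0.
- move=> _ _ [x Nx <-] [y Ny <-]; exists (x + y); rewrite ?mulrDr //.
  exact: neutrixD.
move=> _ y [x Nx <-].
have [->|a0] := eqVneq a 0.
  by rewrite mul0r normr0 normr_le0 => /eqP ->; exists 0; rewrite ?mulr0.
rewrite normrM => yx; exists (a^-1 * y); last by rewrite mulVKf.
apply: neutrix_le Nx _ => //.
by rewrite normrM normfV mulrC ler_pdivrMr ?normr_gt0 // mulrC.
Qed.

Lemma neutrix_mul N M : neutrix N -> neutrix M ->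
  neutrix [set x * y | x in N & y in M].
Proof.
move=> nN nM; have [N0 _ _] := nN; have [M0 _ _] := nM.
have NMle x y z : N x -> M y -> `|z| <= `|x * y| ->
    [set x * y | x in N & y in M] z.
  move=> Nx My; have [->|y0] := eqVneq y 0.
    rewrite mulr0 normr0 normr_le0 => /eqP ->.
    by exists 0 => //; exists 0; rewrite ?mulr0.
  rewrite normrM => zxy; exists (z / y); last by exists y; rewrite ?divfK.
  apply: neutrix_le Nx _ => //.
  by rewrite normrM normfV ler_pdivrMr ?normr_gt0.
apply: neutrix_normP.
- by exists 0 => //; exists 0; rewrite ?mulr0.
- move=> _ _ [x Nx [y My <-]] [x' Nx' [y' My' <-]].
  have [h|/ltW h] := leP `|x * y| `|x' * y'|.
    apply: (NMle (x' + x') y' _ _ My'); first exact: neutrixD.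
    by rewrite mulrDl -mulr2n normrMn mulr2n (le_trans (ler_normD _ _)) // lerD.
  apply: (NMle (x + x) y _ _ My); first exact: neutrixD.
  by rewrite mulrDl -mulr2n normrMn mulr2n (le_trans (ler_normD _ _)) // lerD.
by move=> _ z [x Nx [y My <-]]; apply: NMle.
Qed.

Lemma coset_addE a b N M :
  [set s + t | s in [set a + x | x in N] & t in [set b + y | y in M]]
  = [set (a + b) + z | z in [set x + y | x in N & y in M]].
Proof.
apply/seteqP; split.
  move=> _ [_ [x Nx <-] [_ [y My <-] <-]].
  by exists (x + y); [exists x => //; exists y | ring].
move=> _ [_ [x Nx [y My <-]] <-].
by exists (a + x); [exists x|exists (b + y); [exists y|ring]].
Qed.

Lemma coset_mulE a b N M : neutrix N -> neutrix M ->
  [set s * t | s in [set a + x | x in N] & t in [set b + y | y in M]]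
  = [set a * b + z | z in
      [set u + w | u in [set u + v | u in [set a * y | y in M]
                                   & v in [set b * x | x in N]]
                 & w in [set x * y | x in N & y in M]]].
Proof.
move=> nN nM; have [N0 _ _] := nN; have [M0 _ _] := nM.
apply/seteqP; split.
  move=> _ [_ [x Nx <-] [_ [y My <-] <-]].
  exists (a * y + b * x + x * y); last by ring.
  exists (a * y + b * x); first by exists (a * y); [exists y|exists (b * x) => //; exists x].
  by exists (x * y) => //; exists x => //; exists y.
have naM := neutrix_scale a nM; have nbN := neutrix_scale b nN.
have nNM := neutrix_mul nN nM.
move=> _ [_ [_ [p pM [q qN <-]] [r rNM <-]] <-].
have inM z : [set a * y | y in M] z ->
    [set s * t | s in [set a + x | x in N] & t in [set b + y | y in M]] (a * b + z).
  move=> [y My <-]; exists (a + 0); first by exists 0.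
  by exists (b + y); [exists y|ring].
have inN z : [set b * x | x in N] z ->
    [set s * t | s in [set a + x | x in N] & t in [set b + y | y in M]] (a * b + z).
  move=> [x Nx <-]; exists (a + x); first by exists x.
  by exists (b + 0); [exists 0|ring].
have [abN|nab] := pselect (N a /\ M b).
  have [Na Mb] := abN.
  have [_ [x Nx [y My <-]]] : exists2 z, [set x * y | x in N & y in M] z &
      z = a * b + (p + q + r).
    exists (a * b + (p + q + r)) => //.
    apply: neutrixD => //; first by exists a => //; exists b.
    apply: neutrixD => //; apply: neutrixD => //.
      by case: pM => y My <-; exists a => //; exists y.
    by case: qN => x Nx <-; exists x => //; exists b; rewrite // mulrC.
  move=> <-; exists x.
    by exists (x - a); [case: nN => _ h _; apply: h|ring].
  by exists y => //; exists (y - b); [case: nM => _ h _; apply: h|ring].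
have [rM|rN] : [set a * y | y in M] r \/ [set b * x | x in N] r.
  case: rNM => x Nx [y My <-].
  have [Na|Na] := pselect (N a).
    have Mb : ~ M b by move=> Mb; apply: nab.
    right; apply: (@neutrix_le _ (b * x)) => //; first by exists x.
    by rewrite !normrM mulrC ler_wpM2r // ltW //; apply: neutrix_lt My.
  left; apply: (@neutrix_le _ (a * y)) => //; first by exists y.
  by rewrite !normrM ler_wpM2r // ltW //; apply: neutrix_lt Nx.
- have [h|h] := neutrix_total naM nbN.
    by apply: inN; apply: neutrixD => //; [apply: neutrixD => //; apply: h|apply: h].
  by apply: inM; apply: neutrixD => //; apply: neutrixD => //; apply: h.
have [h|h] := neutrix_total naM nbN.
  by apply: inN; apply: neutrixD => //; apply: neutrixD => //; apply: h.
by apply: inM; apply: neutrixD => //; [apply: neutrixD => //; apply: h|apply: h].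
Qed.

Lemma coset_oppE a N : neutrix N ->
  [set - s | s in [set a + x | x in N]] = [set - a + x | x in N].
Proof.
move=> nN; apply/seteqP; split.
  move=> _ [_ [x Nx <-] <-]; exists (- x); last by ring.
  exact: neutrixN.
move=> _ [x Nx <-]; exists (a - x); last by ring.
by exists (- x) => //; apply: neutrixN.
Qed.

Lemma coset_invE a N : neutrix N -> ~ N a ->
  [set s^-1 | s in [set a + x | x in N]]
  = [set a^-1 + z | z in [set (a ^+ 2)^-1 * x | x in N]].
Proof.
move=> nN Na; have [N0 _ _] := nN.
have a0 : a != 0 by apply/eqP => a0; apply: Na; rewrite a0.
have step x : N x -> a + x != 0 /\ N (- (a * x / (a + x))).
  move=> Nx; have lt2 := neutrix_lt nN Na (neutrixD nN Nx Nx).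
  rewrite -mulr2n normrMn mulr2n in lt2.
  have tri : `|a| <= `|a + x| + `|x|.
    by rewrite -{1}(addrK x a) (le_trans (ler_normB _ _)).
  have ax0 : 0 < `|a + x| by have := normr_ge0 x; lra.
  split; first by rewrite -normr_gt0.
  apply: (neutrix_le nN (neutrixD nN Nx Nx)).
  rewrite normrN !normrM normfV ler_pdivrMr // -mulr2n normrMn -mulr_natl.
  have := normr_ge0 x; nra.
apply/seteqP; split.
  move=> _ [_ [x Nx <-] <-]; have [ax0 Nax] := step x Nx.
  exists ((a ^+ 2)^-1 * (- (a * x / (a + x)))); last by field; rewrite ax0.
  by exists (- (a * x / (a + x))).
move=> _ [_ [x Nx <-] <-]; have [ax0 Nax] := step x Nx.
exists (a - a * x / (a + x)); first by exists (- (a * x / (a + x))).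
have -> : a - a * x / (a + x) = a ^+ 2 / (a + x) by field.
by field; rewrite a0 ax0.
Qed.

End NeutrixTheory.

Section ExternalNumbers.
Variable R : realFieldType.
Implicit Types (a : R) (al be : extnum R).

Definition zeroless al := ~ carrier al 0.

Lemma extnum_eq al be : carrier al = carrier be -> al = be.
Proof.
case: al be => [S hS] [T hT] /= eST; case: T / eST hT => hT.
by congr ExtNum; apply: Prop_irrelevance.
Qed.

Lemma extC_subproof a : external [set a].
Proof.
exists a; exists [set 0]; first exact: neutrix0.
apply/seteqP; split=> [x -> /=|x [y -> <-]]; last by rewrite addr0.
by exists 0; rewrite ?addr0.
Qed.
Definition extC a : extnum R := ExtNum (extC_subproof a).

Lemma ext_add_subproof al be :
  external [set x + y | x in carrier al & y in carrier be].
Proof.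
have [a [N nN ->]] := carrierP al; have [b [M nM ->]] := carrierP be.
rewrite coset_addE; exists (a + b); eexists; last by [].
exact: neutrix_add.
Qed.
Definition ext_add al be : extnum R := ExtNum (ext_add_subproof al be).

Lemma ext_opp_subproof al : external [set - x | x in carrier al].
Proof.
have [a [N nN ->]] := carrierP al.
by rewrite coset_oppE //; exists (- a); exists N.
Qed.
Definition ext_opp al : extnum R := ExtNum (ext_opp_subproof al).

Lemma ext_mul_subproof al be :
  external [set x * y | x in carrier al & y in carrier be].
Proof.
have [a [N nN ->]] := carrierP al; have [b [M nM ->]] := carrierP be.
rewrite coset_mulE //; exists (a * b); eexists; last by [].
by apply: neutrix_add; [apply: neutrix_add; apply: neutrix_scale|apply: neutrix_mul].
Qed.
Definition ext_mul al be : extnum R := ExtNum (ext_mul_subproof al be).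

(* 1 / al is only meaningful for zeroless al; otherwise ext_inv al is al. *)
Definition ext_inv_set al : set R :=
  if `[< zeroless al >] then [set x^-1 | x in carrier al] else carrier al.

Lemma ext_inv_subproof al : external (ext_inv_set al).
Proof.
rewrite /ext_inv_set; case: asboolP => [|_]; last exact: carrierP.
rewrite /zeroless; have [a [N nN ->]] := carrierP al => al0.
have Na : ~ N a.
  by move=> Na; apply: al0; exists (- a); [apply: neutrixN|rewrite addrN].
rewrite coset_invE //; exists a^-1; eexists; last by [].
exact: neutrix_scale.
Qed.
Definition ext_inv al : extnum R := ExtNum (ext_inv_subproof al).

Lemma ext_addA : associative ext_add.
Proof.
move=> al be ga; apply: extnum_eq; apply/seteqP; split=> /=.
  move=> _ [x ax [_ [y by_ [z cz <-]] <-]].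
  by exists (x + y); [exists x => //; exists y|exists z => //; rewrite addrA].
move=> _ [_ [x ax [y by_ <-]] [z cz <-]].
by exists x => //; exists (y + z); [exists y => //; exists z|rewrite addrA].
Qed.

Lemma ext_addC : commutative ext_add.
Proof.
by move=> al be; apply: extnum_eq; apply/seteqP; split=> _ [x ? [y ? <-]];
  exists y => //; exists x; rewrite // addrC.
Qed.

Lemma ext_add0 : left_id (extC 0) ext_add.
Proof.
move=> al; apply: extnum_eq; apply/seteqP; split=> /=.
  by move=> _ [_ -> [y ay <-]]; rewrite add0r.
by move=> y ay; exists 0 => //; exists y; rewrite ?add0r.
Qed.

Lemma ext_mulA : associative ext_mul.
Proof.
move=> al be ga; apply: extnum_eq; apply/seteqP; split=> /=.
  move=> _ [x ax [_ [y by_ [z cz <-]] <-]].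
  by exists (x * y); [exists x => //; exists y|exists z => //; rewrite mulrA].
move=> _ [_ [x ax [y by_ <-]] [z cz <-]].
by exists x => //; exists (y * z); [exists y => //; exists z|rewrite mulrA].
Qed.

Lemma ext_mulC : commutative ext_mul.
Proof.
by move=> al be; apply: extnum_eq; apply/seteqP; split=> _ [x ? [y ? <-]];
  exists y => //; exists x; rewrite // mulrC.
Qed.

Lemma ext_mul1 : left_id (extC 1) ext_mul.
Proof.
move=> al; apply: extnum_eq; apply/seteqP; split=> /=.
  by move=> _ [_ -> [y ay <-]]; rewrite mul1r.
by move=> y ay; exists 1 => //; exists y; rewrite ?mul1r.
Qed.

End ExternalNumbers.

(* Addition is a commutative monoid law, but extnum is not an additive group
   (al - al is the neutrix part of al) nor a semiring (distributivity fails). *)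
HB.instance Definition _ (R : realFieldType) :=
  GRing.isNmodule.Build (extnum R)
    (@ext_addA R) (@ext_addC R) (@ext_add0 R).

HB.instance Definition _ (R : realFieldType) :=
  Monoid.isComLaw.Build (extnum R) (extC 1) (@ext_mul R)
    (@ext_mulA R) (@ext_mulC R) (@ext_mul1 R).

Declare Scope ext_scope.
Delimit Scope ext_scope with X.
Notation "x + y" := (GRing.add x%X y%X) : ext_scope.
Notation "- x" := (ext_opp x) : ext_scope.
Notation "x - y" := (x + - y)%X : ext_scope.
Notation "x * y" := (ext_mul x y) : ext_scope.
Notation "x ^-1" := (ext_inv x) : ext_scope.
Notation "x / y" := (x * y^-1)%X : ext_scope.
Local Open Scope ext_scope.

Section Order.
Variable R : realFieldType.
Implicit Types (al be : extnum R) (N M : extnum R).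

Definition ext_le al be :=
  forall x, carrier al x -> exists2 y, carrier be y & (x <= y)%R.

Definition ext_max al be := if `[< ext_le al be >] then be else al.

Definition ext_abs al := if `[< ext_le (extC 0) al >] then al else - al.

Definition ext_exp al (n : nat) := \big[@ext_mul R/extC 1]_(i < n) al.

Definition npart al : extnum R := al - al.

Lemma npartE a S al : neutrix S -> carrier al = [set (a + x)%R | x in S] ->
  carrier (npart al) = S.
Proof.
move=> nS alE; rewrite /npart /= alE coset_oppE // coset_addE subrr.
have [S0 _ _] := nS; apply/seteqP; split.
  by move=> _ [_ [x Sx [y Sy <-]] <-]; rewrite add0r; apply: neutrixD.
by move=> x Sx; exists x; [exists x => //; exists 0; rewrite ?addr0|rewrite add0r].
Qed.

Definition neutrix_max N M := if `[< carrier N `<=` carrier M >] then M else N.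

Definition absorber al N := carrier (al * N) `<` carrier N.

End Order.

Section Matrices.
Variable R : realFieldType.

Definition ext_mulmx m n p (A : 'M[extnum R]_(m, n)) (B : 'M[extnum R]_(n, p)) :=
  \matrix_(i < m, k < p) \sum_(j < n) (A i j * B j k)%X.

Definition ext_subset m n (A B : 'M[extnum R]_(m, n)) :=
  forall i j, carrier (A i j) `<=` carrier (B i j).

Definition ext_scalemx m n (al : extnum R) (A : 'M[extnum R]_(m, n)) :=
  \matrix_(i < m, j < n) (al * A i j)%X.

Definition ext_det n (A : 'M[extnum R]_n) : extnum R :=
  \sum_(s : 'S_n)
    (extC ((-1) ^+ s)%R * \big[@ext_mul R/extC 1]_(i < n) A i (s i))%X.

Definition ext_cofactor n (A : 'M[extnum R]_n) : 'M[extnum R]_n :=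
  \matrix_(i < n, j < n)
    (extC ((-1) ^+ (i + j))%R * ext_det (row' i (col' j A)))%X.

Definition nonsingular n (A : 'M[extnum R]_n) := zeroless (ext_det A).

(* 0 is the least neutrix and the least of all |al|, so that starting the
   iterated maxima from 0 only matters for empty matrices. *)
Definition max_npart n (A : 'M[extnum R]_n) : extnum R :=
  \big[@neutrix_max R/0%R]_(ij : 'I_n * 'I_n) npart (A ij.1 ij.2).

Definition max_abs n (A : 'M[extnum R]_n) : extnum R :=
  \big[@ext_max R/0%R]_(ij : 'I_n * 'I_n) ext_abs (A ij.1 ij.2).

Definition relative_det n (A : 'M[extnum R]_n) : extnum R :=
  ext_det A / ext_exp (max_abs A) n.

Definition near_id n (N : extnum R) : 'M[extnum R]_n :=
  \matrix_(i < n, j < n) (if i == j then extC 1 + N else N)%X.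

(* near_id is only considered for neutrices of infinitesimals. *)
Definition inverse_wrt n (N : extnum R) (A B : 'M[extnum R]_n) :=
  [/\ neutrix (carrier N), carrier N `<=` @infinitesimals R,
      ext_subset (ext_mulmx A B) (near_id n N)
    & ext_subset (ext_mulmx B A) (near_id n N)].

Definition invertible_wrt n (N : extnum R) (A : 'M[extnum R]_n) :=
  exists B, inverse_wrt N A B.

End Matrices.

(* Main.v *)
Require Import Defs.
From mathcomp Require Import all_boot all_order all_algebra.
From mathcomp Require Import boolp classical_sets.
From mathcomp Require Import ring lra.

Set Implicit Arguments.
Unset Strict Implicit.
Unset Printing Implicit Defensive.
Import Order.TTheory GRing.Theory Num.Theory.
Local Open Scope ring_scope.
Local Open Scope classical_set_scope.

(** The theorem is Cramer's rule read modulo a neutrix. Fix an element m of the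
    maximum of the |alpha_ij|, write K for the maximal neutrix part of A, and
    put N = K / m, which is the neutrix K / max |alpha_ij| of the theorem.

    Since the maximum is zeroless, every element of an entry is at most 2|m| in
    absolute value. Hence, after division by m, the entries consist of limited
    numbers, two elements of the same entry differ by an element of N, and N is
    bounded, so made of infinitesimals. A neutrix is stable under
    multiplication by limited numbers: N is an ideal of the ring of limited
    numbers, and congruence modulo N is compatible with sums and products. Let
    a be the real matrix of the scaled representatives. Determinants and
    cofactors are homogeneous polynomials, so every element of det A / m^n is
    congruent to det a, and every element of a cofactor divided by m^(n-1) is
    congruent to the same cofactor of a. The Minkowski operations pick their
    representatives independently and are not distributive, but this costs
    nothing, because the congruence holds for all choices at once
    ([tracks_det], [tracks_cofactor]).

    What remains is the division by the determinant, which may be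
    infinitesimal. The elements of R(A) are limited, so R(A) K is included in
    K; as R(A) does not absorb K, the inclusion is an equality. Because R(A) is
    zeroless, its elements have comparable sizes, so division by any scaled
    element of det A maps N into itself ([nonabsorber_div]), and then so does
    division by det a ([det_div]). Therefore each product of an element of an
    entry, one of 1 / det A and one of a cofactor differs from the
    corresponding a_ij cof_kl(a) / det a by an element of N ([adjugate_term]).
    Summing, and using that a adj(a) = adj(a) a = det(a) I for the real matrix
    a, puts the entries of both products inside I_n(N). *)

(** * Limited numbers act on neutrices *)

Section Limited.
Variable R : realFieldType.
Implicit Types (x y u c d : R) (N : set R).

Lemma limited_nat (k : nat) : limited (k%:R : R).
Proof. by exists k; rewrite ger0_norm. Qed.

Lemma limitedN x : limited x -> limited (- x).
Proof. by case=> k xk; exists k; rewrite normrN. Qed.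

Lemma limitedD x y : limited x -> limited y -> limited (x + y).
Proof.
move=> [k xk] [l yl]; exists (k + l)%N.
by rewrite natrD (le_trans (ler_normD _ _)) ?lerD.
Qed.

Lemma limitedM x y : limited x -> limited y -> limited (x * y).
Proof. by move=> [k xk] [l yl]; exists (k * l)%N; rewrite natrM normrM ler_pM. Qed.

Lemma limited_sign (k : nat) : limited ((-1) ^+ k : R).
Proof. by exists 1%N; rewrite normrX normrN1 expr1n. Qed.

Lemma neutrix_natM N (k : nat) x : neutrix N -> N x -> N (k%:R * x).
Proof.
move=> nN Nx; elim: k => [|k IHk]; first by rewrite mul0r; case: nN.
by rewrite -natr1 mulrDl mul1r; apply: neutrixD.
Qed.

Lemma neutrix_limitedM N x y : neutrix N -> limited x -> N y -> N (x * y).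
Proof.
move=> nN [k xk] Ny; apply: neutrix_le (neutrix_natM k nN Ny) _ => //.
by rewrite !normrM ler_wpM2r // (le_trans xk) // ler_norm.
Qed.

(** A nonzero x in N has all its integer multiples below k, so its inverse
    cannot be limited. *)
Lemma bounded_neutrix_infinitesimal N (k : nat) : neutrix N ->
  (forall x, N x -> `|x| <= k%:R) -> N `<=` @infinitesimals R.
Proof.
move=> nN Nk x Nx; have [->|x0] := eqVneq x 0; first by left.
right; exists x^-1; last by rewrite invrK.
move=> [j xj]; have := Nk _ (neutrix_natM (k.+1 * j) nN Nx).
have x_gt0 : 0 < `|x| by rewrite normr_gt0.
have jx : 1 <= j%:R * `|x|.
  by rewrite -ler_pdivrMr // div1r -normfV.
have : k.+1%:R <= k.+1%:R * (j%:R * `|x|) :> R by rewrite ler_peMr.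
rewrite natrM !normrM !normr_nat -natr1; lra.
Qed.

Lemma infinitesimal_le_half x : infinitesimals x -> `|x| <= 2^-1.
Proof.
case=> [->|[y yu ->]]; first by rewrite normr0 invr_ge0.
have y2 : 2 < `|y| by rewrite ltNge; apply/negP => y2; apply: yu; exists 2%N.
by rewrite normfV lef_pV2 ?posrE //; lra.
Qed.

End Limited.

(** * Congruence modulo a neutrix *)

Section Tracking.
Variables (R : realFieldType) (N : set R).
Hypothesis nN : neutrix N.
Implicit Types (x y u c d : R) (al be : extnum R).

(** Limitedness is part of the relation so that it is stable under products. *)
Definition cong x y := [/\ limited x, limited y & N (x - y)].

Lemma cong_refl x : limited x -> cong x x.
Proof. by move=> lx; split; rewrite // subrr; case: nN. Qed.

Lemma congD x y c d : cong x c -> cong y d -> cong (x + y) (c + d).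
Proof.
move=> [lx lc Nxc] [ly ld Nyd]; split; [exact: limitedD|exact: limitedD|].
by rewrite opprD addrACA; apply: neutrixD.
Qed.

Lemma congM x y c d : cong x c -> cong y d -> cong (x * y) (c * d).
Proof.
move=> [lx lc Nxc] [ly ld Nyd]; split; [exact: limitedM|exact: limitedM|].
have -> : x * y - c * d = x * (y - d) + d * (x - c) by ring.
by apply: neutrixD => //; apply: neutrix_limitedM.
Qed.

(** The scale u records the degree of homogeneity: it is multiplied along
    products and shared by the terms of a sum. *)
Definition tracks u al c := forall s, carrier al s -> cong (s / u) c.

Lemma tracksC c : limited c -> tracks 1 (extC c) c.
Proof. by move=> lc _ ->; rewrite divr1; apply: cong_refl. Qed.

Lemma tracksD u al be c d :
  tracks u al c -> tracks u be d -> tracks u (al + be)%X (c + d).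
Proof.
by move=> alc bed _ [x ax [y by_ <-]]; rewrite mulrDl; apply: congD; auto.
Qed.

Lemma tracksM u v al be c d :
  tracks u al c -> tracks v be d -> tracks (u * v) (al * be)%X (c * d).
Proof.
by move=> alc bed _ [x ax [y by_ <-]]; rewrite invfM mulrACA; apply: congM; auto.
Qed.

Lemma tracks_sum u (I : finType) (F : I -> extnum R) (f : I -> R) :
  (forall i, tracks u (F i) (f i)) -> tracks u (\sum_i F i) (\sum_i f i).
Proof.
move=> Ff; apply: (big_ind2 (tracks u)) => //; last by move=> *; apply: tracksD.
move=> _ ->; rewrite mul0r; apply: cong_refl; exact: (limited_nat R 0).
Qed.

Lemma tracks_prod u n (F : 'I_n -> extnum R) (f : 'I_n -> R) :
  (forall i, tracks u (F i) (f i)) ->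
  tracks (u ^+ n) (\big[@ext_mul R/extC 1]_(i < n) F i) (\prod_(i < n) f i).
Proof.
move=> Ff; rewrite -[n in u ^+ n]card_ord -prodr_const.
apply: (big_rec3 (fun al c v => tracks v al c)) => [|i al c v _ alc].
  exact: tracksC (limited_nat R 1).
exact: tracksM.
Qed.

Lemma tracks_det u n (A : 'M[extnum R]_n) (a : 'M[R]_n) :
  (forall i j, tracks u (A i j) (a i j)) -> tracks (u ^+ n) (ext_det A) (\det a).
Proof.
move=> Aa; apply: tracks_sum => s; rewrite -[u ^+ n]mul1r.
by apply: tracksM; [apply/tracksC/limited_sign|apply: tracks_prod].
Qed.

Lemma tracks_cofactor u n (A : 'M[extnum R]_n) (a : 'M[R]_n) i j :
  (forall i j, tracks u (A i j) (a i j)) ->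
  tracks (u ^+ n.-1) (ext_cofactor A i j) (cofactor a i j).
Proof.
move=> Aa; rewrite mxE -[u ^+ _]mul1r.
apply: tracksM; first exact/tracksC/limited_sign.
by apply: tracks_det => k l; rewrite !mxE.
Qed.

(** The quotients need not be limited, hence a conclusion weaker than [cong];
    it suffices that division by either denominator preserves N, because
    x / y - c / d = (x - c) / y - c ((y - d) / y) / d. *)
Lemma quotient_close x y c d : d != 0 -> y != 0 ->
  (forall z, N z -> N (z / y)) -> (forall z, N z -> N (z / d)) ->
  cong x c -> cong y d -> N (x / y - c / d).
Proof.
move=> d0 y0 Ny Nd [_ lc Nxc] [_ _ Nyd].
have -> : x / y - c / d = (x - c) / y + - c * ((y - d) / y / d).
  by field; rewrite d0 y0.
apply: neutrixD; [by []|exact: Ny|].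
by apply: neutrix_limitedM; [|exact: limitedN|apply/Nd/Ny].
Qed.

End Tracking.

(** * Iterated maxima for a total preorder *)

Section Maxima.

(** Both the maximum of neutrices and that of external numbers are chosen by
    cases on a preorder; the predicate P is there because inclusion is total
    only among neutrices. *)
Lemma big_max_ge (T : Type) (le : T -> T -> Prop) (P : T -> Prop)
    (op : T -> T -> T) (x0 : T) (I : finType) (F : I -> T) i :
  (forall x, P x -> le x x) ->
  (forall x y, P x -> P y -> le x y \/ le y x) ->
  (forall x y z, le x y -> le y z -> le x z) ->
  (forall x y, op x y = if `[< le x y >] then y else x) ->
  P x0 -> (forall i, P (F i)) -> le (F i) (\big[op/x0]_j F j).
Proof.
move=> le_refl le_total le_trans opE Px0 PF.
have Pop x y : P x -> P y -> P (op x y) by rewrite opE; case: asboolP.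
have : i \in index_enum I by rewrite mem_index_enum.
elim: (index_enum I) => // j r IHr; rewrite big_cons inE => ijr.
have Pr : P (\big[op/x0]_(k <- r) F k) by apply: big_ind.
have jr := le_total _ _ (PF j) Pr.
have [/eqP ->|/IHr ir] := orP ijr; rewrite opE; case: asboolP => // nle.
  exact: le_refl.
by apply: le_trans ir _; case: jr.
Qed.

Lemma big_max_attained (T : Type) (le : T -> T -> Prop)
    (op : T -> T -> T) (x0 : T) (I : finType) (F : I -> T) :
  (forall x y, op x y = if `[< le x y >] then y else x) ->
  \big[op/x0]_j F j = x0 \/ exists i, \big[op/x0]_j F j = F i.
Proof.
move=> opE; apply: (big_ind (fun x => x = x0 \/ exists i, x = F i)).
- by left.
- by move=> x y ? ?; rewrite opE; case: asboolP.
by move=> i _; right; exists i.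
Qed.

End Maxima.

(** * Size and neutrix part of external numbers *)

Section ExternalNumberFacts.
Variable R : realFieldType.
Implicit Types (al be : extnum R).

Lemma ext_le_refl al : ext_le al al.
Proof. by move=> x ax; exists x. Qed.

Lemma ext_le_trans al be ga : ext_le al be -> ext_le be ga -> ext_le al ga.
Proof.
move=> ab bg x /ab[y /bg[z gz yz] xy]; exists z => //; exact: le_trans yz.
Qed.

Lemma ext_le_total al be : ext_le al be \/ ext_le be al.
Proof.
have [|nle] := pselect (ext_le al be); first by left.
right=> y by_; apply: contrapT => ny; apply: nle => x ax.
exists y => //; case: (leP x y) => // /ltW yx.
by case: ny; exists x.
Qed.

Lemma extnum_inhabited al : exists x, carrier al x.
Proof.
have [a [N [N0 _ _] ->]] := carrierP al.
by exists (a + 0), 0.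
Qed.

Lemma npart_sub al s t :
  carrier al s -> carrier al t -> carrier (npart al) (s - t).
Proof. by move=> als alt; exists s => //; exists (- t) => //; exists t. Qed.

Lemma npart_neutrix al : neutrix (carrier (npart al)).
Proof. by have [a [N nN alE]] := carrierP al; rewrite (npartE nN alE). Qed.

Lemma zeroless_neq0 al s : zeroless al -> carrier al s -> s != 0.
Proof. by move=> al0 als; apply/eqP => s0; apply: al0; rewrite -s0. Qed.

(** If t belonged to the neutrix part, so would every representative, and the
    external number would contain 0; and an element of a neutrix is smaller
    than any number outside of it. *)
Lemma zeroless_sub_lt al s t :
  zeroless al -> carrier al s -> carrier al t -> `|s - t| < `|t|.
Proof.
rewrite /zeroless; have [a [N nN alE]] := carrierP al => al0 als alt.
apply: (@neutrix_lt _ N) => //; last first.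
  by rewrite -(npartE nN alE); apply: npart_sub.
move=> Nt; apply: al0; move: alt; rewrite alE => -[x Nx axt].
exists (- a); last by rewrite addrN.
apply: neutrixN => //; case: nN => _ NB _.
by rewrite -[a](addrK x) axt; apply: NB.
Qed.

Lemma zeroless_le_double al s t :
  zeroless al -> carrier al s -> carrier al t -> `|s| <= 2 * `|t|.
Proof.
move=> al0 als alt; have := zeroless_sub_lt al0 als alt.
by have := ler_normD (s - t) t; rewrite subrK; lra.
Qed.

Lemma zeroless_invP al s : zeroless al ->
  carrier (ext_inv al) s -> exists2 t, carrier al t & s = t^-1.
Proof.
by rewrite /= /ext_inv_set => al0; case: asboolP => // _ [t alt <-]; exists t.
Qed.

Lemma zeroless_inv_mem al t : zeroless al ->
  carrier al t -> carrier (ext_inv al) t^-1.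
Proof.
by rewrite /= /ext_inv_set => al0 alt; case: asboolP => // _; exists t.
Qed.

Lemma ext_abs_norm al s : carrier al s -> carrier (ext_abs al) `|s|.
Proof.
rewrite /ext_abs => als; case: asboolP => [al_ge0|al_lt0]; last first.
  have s_lt0 : s < 0.
    by rewrite ltNge; apply/negP => s0; apply: al_lt0 => _ ->; exists s.
  by rewrite ltr0_norm //; exists s.
case: (ger0P s) => // s_lt0.
have [y aly y0] := al_ge0 0 erefl.
(* By convexity 0 lies between s and y, so that al is a neutrix. *)
have [a [N nN alE]] := carrierP al.
move: als aly; rewrite alE => -[x Nx axs] [z Nz azy].
have [N0 NB NC] := nN.
have Ns : N s.
  apply: (NC (s - y) 0) => //; last by apply/andP; split; lra.
  have -> : s - y = x - z by rewrite -axs -azy; ring.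
  exact: NB.
have Na : N a by rewrite -[a](addrK x) axs; apply: NB.
by exists (- s - a); [apply: NB => //; apply: neutrixN|ring].
Qed.

Lemma ext_abs_sub al s t : carrier (ext_abs al) s -> carrier (ext_abs al) t ->
  carrier (npart al) (s - t).
Proof.
rewrite /ext_abs; case: asboolP => _; first exact: npart_sub.
move=> [x alx <-] [y aly <-].
have -> : - x - - y = y - x by ring.
exact: npart_sub.
Qed.

End ExternalNumberFacts.

(** * Bounds on the entries of a matrix *)

Section MatrixBounds.
Variables (R : realFieldType) (n : nat) (A : 'M[extnum R]_n).

Lemma max_npart_attained :
  max_npart A = 0 \/ exists i j, max_npart A = npart (A i j).
Proof.
have [|[[i j]]] := @big_max_attained _ _ (@neutrix_max R) 0 _
  (fun ij : 'I_n * 'I_n => npart (A ij.1 ij.2)) (fun _ _ => erefl); first by left.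
by right; exists i, j.
Qed.

Lemma max_abs_attained :
  max_abs A = 0 \/ exists i j, max_abs A = ext_abs (A i j).
Proof.
have [|[[i j]]] := @big_max_attained _ _ (@ext_max R) 0 _
  (fun ij : 'I_n * 'I_n => ext_abs (A ij.1 ij.2)) (fun _ _ => erefl); first by left.
by right; exists i, j.
Qed.

Lemma max_npart_neutrix : neutrix (carrier (max_npart A)).
Proof.
have [->|[i [j ->]]] := max_npart_attained.
  exact: neutrix0.
exact: npart_neutrix.
Qed.

Lemma npart_le_max i j : carrier (npart (A i j)) `<=` carrier (max_npart A).
Proof.
apply: (@big_max_ge _ (fun x y => carrier x `<=` carrier y)
  (fun x => neutrix (carrier x)) (@neutrix_max R) 0 _
  (fun ij : 'I_n * 'I_n => npart (A ij.1 ij.2)) (i, j)) => //.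
- by move=> x _; apply: subset_refl.
- by move=> x y; apply: neutrix_total.
- by move=> x y z; apply: subset_trans.
- exact: neutrix0.
by move=> ij; apply: npart_neutrix.
Qed.

Lemma abs_le_max i j : ext_le (ext_abs (A i j)) (max_abs A).
Proof.
apply: (@big_max_ge _ (@ext_le R) (fun=> True) (@ext_max R) 0 _
  (fun ij : 'I_n * 'I_n => ext_abs (A ij.1 ij.2)) (i, j)) => //.
- by move=> x _; apply: ext_le_refl.
- by move=> x y _ _; apply: ext_le_total.
by move=> x y z; apply: ext_le_trans.
Qed.

Hypothesis M0 : zeroless (max_abs A).

(** The maximal absolute value is attained by an entry, up to sign, so its
    neutrix part is at most the largest one. *)
Lemma max_abs_sub s t : carrier (max_abs A) s -> carrier (max_abs A) t ->
  carrier (max_npart A) (s - t).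
Proof.
have [M_0|[i [j ->]]] := max_abs_attained; first by case: M0; rewrite M_0.
by move=> Ms Mt; apply: (@npart_le_max i j); apply: ext_abs_sub.
Qed.

Lemma entry_le i j s m : carrier (A i j) s -> carrier (max_abs A) m ->
  `|s| <= 2 * `|m|.
Proof.
move=> As Mm; have [y My sy] := abs_le_max (ext_abs_norm As).
apply: le_trans sy _; apply: le_trans (ler_norm _) _.
exact: zeroless_le_double Mm.
Qed.

(** The largest neutrix may come from another entry than the largest absolute
    value; the bound holds since an element of a neutrix part is a difference
    of two elements of an entry. *)
Lemma max_npart_le x m : carrier (max_npart A) x -> carrier (max_abs A) m ->
  `|x| <= 4 * `|m|.
Proof.
have [->|[i [j ->]]] := max_npart_attained.
  by move=> -> _; rewrite normr0 mulr_ge0.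
move=> [s As [_ [t At <-] <-]] Mm; apply: le_trans (ler_normB _ _) _.
have := entry_le As Mm; have := entry_le At Mm; lra.
Qed.

End MatrixBounds.

(** * The scaled matrix and division by its determinant *)

Section Scaled.
Variables (R : realFieldType) (n : nat) (A : 'M[extnum R]_n) (m : R).
Hypotheses (M0 : zeroless (max_abs A)) (Mm : carrier (max_abs A) m).

Let N : set R := [set x | carrier (max_npart A) (m * x)].
Let NE x : N x = carrier (max_npart A) (m * x) := erefl.
Let m0 : m != 0 := zeroless_neq0 M0 Mm.

(** Dividing by other elements of the maximum gives nothing new: they are at
    least |m| / 2, and N is stable under doubling. *)
Lemma scaled_npartE : carrier (max_npart A / max_abs A)%X = N.
Proof.
have nK := max_npart_neutrix A.
apply/seteqP; split=> [_ [x Kx [_ /(zeroless_invP M0)[y My ->] <-]]|x Nx].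
  have y0 := zeroless_neq0 M0 My.
  apply: neutrix_le (neutrix_natM 2 nK Kx) _ => //.
  rewrite !normrM normfV normr_nat mulrA ler_pdivrMr ?normr_gt0 //.
  have := zeroless_le_double M0 Mm My; have := normr_ge0 x; nra.
exists (m * x) => //; exists m^-1; first exact: zeroless_inv_mem.
by rewrite mulrC mulKf.
Qed.

Lemma scaled_neutrix : neutrix N.
Proof.
have nK := max_npart_neutrix A; apply: neutrix_normP.
- by rewrite NE mulr0; case: nK.
- by move=> x y Nx Ny; rewrite NE mulrDr; apply: neutrixD.
move=> x y Nx yx; apply: (neutrix_le nK Nx).
by rewrite !normrM ler_wpM2l.
Qed.

Lemma scaled_infinitesimal : N `<=` @infinitesimals R.
Proof.
apply: (bounded_neutrix_infinitesimal (k := 4) scaled_neutrix) => x Nx.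
have := max_npart_le M0 Nx Mm.
by rewrite normrM mulrC ler_pM2r // normr_gt0.
Qed.

Lemma tracks_entry i j a :
  carrier (A i j) a -> tracks N m (A i j) (a / m).
Proof.
have lim s : carrier (A i j) s -> limited (s / m).
  move=> As; exists 2%N; rewrite normrM normfV ler_pdivrMr ?normr_gt0 //.
  exact: (entry_le M0 As Mm).
move=> Aa s As; split; [exact: lim|exact: lim|].
rewrite NE -mulrBl mulrC divfK //.
by apply: (@npart_le_max _ _ _ i j); apply: npart_sub.
Qed.

Lemma tracks_max_exp : tracks N (m ^+ n) (ext_exp (max_abs A) n) 1.
Proof.
have <- : \prod_(i < n) (1 : R) = 1 by rewrite big1_eq.
apply: tracks_prod; first exact: scaled_neutrix.
move=> _ y My; split; last 2 first.
- exact: (limited_nat R 1).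
- by rewrite NE mulrBr mulr1 mulrC divfK //; apply: max_abs_sub.
exists 2%N; rewrite normrM normfV ler_pdivrMr ?normr_gt0 //.
exact: zeroless_le_double Mm.
Qed.

Lemma max_exp_ge z : carrier (ext_exp (max_abs A) n) z ->
  2^-1 <= `|z / m ^+ n|.
Proof.
move=> /tracks_max_exp[_ _ /scaled_infinitesimal/infinitesimal_le_half].
rewrite -normrN opprB => h.
have := ler_normD (1 - z / m ^+ n) (z / m ^+ n); rewrite subrK normr1; lra.
Qed.

Lemma max_exp_zeroless : zeroless (ext_exp (max_abs A) n).
Proof. by move=> /max_exp_ge; rewrite mul0r normr0; lra. Qed.

Hypothesis D0 : nonsingular A.
Hypothesis RA : ~ absorber (relative_det A) (max_npart A).
Variable a : 'M[R]_n.
Hypothesis Aa : forall i j, tracks N m (A i j) (a i j).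

Let mn0 : m ^+ n != 0. Proof. exact: expf_neq0. Qed.
Let nN := scaled_neutrix.

(** A proper inclusion of R(A) K in K would be absorption, so it is enough that
    R(A) K is included in K, that is, that the elements of R(A) are limited. *)
Lemma max_npart_sub_relative_det :
  carrier (max_npart A) `<=` carrier (relative_det A * max_npart A)%X.
Proof.
apply: contrapT => nsub; apply: RA; split=> //.
move=> _ [_ [d Dd [_ /(zeroless_invP max_exp_zeroless)[z Ez ->] <-]] [x Kx <-]].
have [ld _ _] := tracks_det nN Aa Dd.
have z2 := max_exp_ge Ez.
have z0 : z != 0 := zeroless_neq0 max_exp_zeroless Ez.
apply: neutrix_limitedM => //; first exact: max_npart_neutrix.
have -> : d / z = d / m ^+ n * (z / m ^+ n)^-1.
  by rewrite invfM invrK [_^-1 * _]mulrC mulrA divfK.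
apply: limitedM => //; exists 2%N.
by rewrite normfV -[2%:R]invrK lef_pV2 // posrE; lra.
Qed.

(** Write m x = (e / z) y with e in det A, z in the n-th power of the maximum
    and y in K. Then m x / (d / m^n) is y times (e / d) / (z / m^n), whose first
    factor is at most 2 because det A is zeroless and whose divisor is at least
    1/2. *)
Lemma nonabsorber_div d x : carrier (ext_det A) d -> N x -> N (x / (d / m ^+ n)).
Proof.
move=> Dd /max_npart_sub_relative_det.
move=> [_ [e De [_ /(zeroless_invP max_exp_zeroless)[z Ez ->] <-]] [y Ky yE]].
have z2 := max_exp_ge Ez.
have z0 := zeroless_neq0 max_exp_zeroless Ez.
have d0 := zeroless_neq0 D0 Dd.
have ed := zeroless_le_double D0 De Dd.
rewrite NE mulrA -yE.
apply: (neutrix_le (max_npart_neutrix A)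
  (neutrix_natM 4 (max_npart_neutrix A) Ky)).
have -> : e / z * y / (d / m ^+ n) = (e / d / (z / m ^+ n)) * y.
  by field; rewrite d0 z0 mn0.
set w := z / m ^+ n in z2 *; have d_gt0 : 0 < `|d| by rewrite normr_gt0.
rewrite !normrM !normfV normr_nat ler_wpM2r // ler_pdivrMr; last by lra.
rewrite ler_pdivrMr //; nra.
Qed.

(** The relative error (d / m^n - det a) / (d / m^n) is in N, thus at most 1/2.
    This is how nonsingularity of A passes to the real matrix a. *)
Lemma det_lower d : carrier (ext_det A) d ->
  `|d / m ^+ n| <= 2 * `|\det a|.
Proof.
move=> Dd; have [_ _ Ndet] := tracks_det nN Aa Dd.
have q0 : 0 < `|d / m ^+ n|.
  by rewrite normr_gt0 mulf_neq0 ?invr_eq0 // (zeroless_neq0 D0 Dd).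
have /scaled_infinitesimal/infinitesimal_le_half := nonabsorber_div Dd Ndet.
rewrite normrM normfV ler_pdivrMr //.
have := ler_normD (d / m ^+ n - \det a) (\det a); rewrite subrK; lra.
Qed.

Lemma det_neq0 : \det a != 0.
Proof.
have [d Dd] := extnum_inhabited (ext_det A).
apply/eqP => da0; have := det_lower Dd; rewrite da0 normr0 mulr0 normr_le0.
by rewrite mulf_eq0 invr_eq0 (negPf mn0) orbF; apply/negP/(zeroless_neq0 D0 Dd).
Qed.

Lemma det_div x : N x -> N (x / \det a).
Proof.
have [d Dd] := extnum_inhabited (ext_det A).
have w_gt0 : 0 < `|d / m ^+ n|.
  by rewrite normr_gt0 mulf_neq0 ?invr_eq0 // (zeroless_neq0 D0 Dd).
have Delta_gt0 : 0 < `|\det a| by rewrite normr_gt0 det_neq0.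
move=> /(nonabsorber_div Dd) /(neutrix_natM 2 nN) Nx.
apply: neutrix_le Nx _ => //; have := det_lower Dd.
move: (d / m ^+ n) w_gt0 => w w_gt0 w_le.
rewrite !normrM !normfV normr_nat [2 * _]mulrCA ler_wpM2l //.
by rewrite ler_pdivlMr // mulrC ler_pdivrMr // mulrC.
Qed.

Lemma adjugate_term i j k l s :
  carrier (A i j * ((ext_det A)^-1 * ext_cofactor A k l))%X s ->
  N (s - a i j * cofactor a k l / \det a).
Proof.
move=> [x Ax [_ [_ /(zeroless_invP D0)[d Dd ->] [c Cc <-]] <-]].
have d0 := zeroless_neq0 D0 Dd.
have n_gt0 : (0 < n)%N by exact: (leq_ltn_trans (leq0n i) (ltn_ord i)).
have -> : x * (d^-1 * c) = (x / m * (c / m ^+ n.-1)) / (d / m ^+ n).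
  have -> : m ^+ n = m * m ^+ n.-1 by rewrite -exprS prednK.
  by field; rewrite d0 m0 expf_neq0.
apply: quotient_close => //.
- exact: det_neq0.
- by rewrite mulf_neq0 ?invr_eq0.
- by move=> z; apply: nonabsorber_div.
- exact: det_div.
- by apply: congM => //; [apply: Aa|apply: tracks_cofactor Cc].
exact: tracks_det.
Qed.

Lemma sum_close (F : 'I_n -> extnum R) (f : 'I_n -> R) :
  (forall j s, carrier (F j) s -> N (s - f j)) ->
  forall s, carrier (\sum_j F j) s -> N (s - \sum_j f j).
Proof.
move=> Ff; apply: (big_ind2 (fun al c => forall s, carrier al s -> N (s - c))).
- by move=> _ ->; rewrite subrr; case: nN.
- move=> al c be d alc bed _ [x ax [y by_ <-]].
  by rewrite opprD addrACA; apply: neutrixD => //; auto.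
by move=> j _; apply: Ff.
Qed.

Lemma near_id_mem i k s : N (s - (i == k)%:R) ->
  carrier (near_id n (max_npart A / max_abs A)%X i k) s.
Proof.
rewrite mxE -scaled_npartE; case: eqP => _ Ns; last by rewrite subr0 in Ns.
exists 1 => //; exists (s - 1) => //.
by rewrite addrC subrK.
Qed.

Lemma adjugate_inverse :
  inverse_wrt (max_npart A / max_abs A)%X A
    (ext_scalemx (ext_det A)^-1%X (ext_cofactor A)^T).
Proof.
have adjE j k : ext_scalemx (ext_det A)^-1%X (ext_cofactor A)^T j k
    = ((ext_det A)^-1 * ext_cofactor A k j)%X by rewrite mxE [_^T _ _]mxE.
split; rewrite ?scaled_npartE; [exact: nN|exact: scaled_infinitesimal| |].
- move=> i k s; rewrite mxE => Ss; apply: near_id_mem.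
  suff <- : \sum_j a i j * cofactor a k j / \det a = (i == k)%:R.
    by apply: (sum_close _ Ss) => j t; rewrite adjE; apply: adjugate_term.
  have /matrixP/(_ i k) := mul_mx_adj a; rewrite !mxE => E.
  rewrite -mulr_suml.
  have -> : \sum_j a i j * cofactor a k j = \det a *+ (i == k).
    by rewrite -E; apply: eq_bigr => j _; rewrite mxE.
  by rewrite mulrnAl divff ?det_neq0.
move=> i k s; rewrite mxE => Ss; apply: near_id_mem.
suff <- : \sum_j a j k * cofactor a j i / \det a = (i == k)%:R.
  apply: (sum_close _ Ss) => j t; rewrite adjE ext_mulC.
  exact: adjugate_term.
have /matrixP/(_ i k) := mul_adj_mx a; rewrite !mxE => E.
rewrite -mulr_suml.
have -> : \sum_j a j k * cofactor a j i = \det a *+ (i == k).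
  by rewrite -E; apply: eq_bigr => j _; rewrite mxE mulrC.
by rewrite mulrnAl divff ?det_neq0.
Qed.

End Scaled.

Theorem theorem5p5 (R : realFieldType) (hR : nonstandard R) (n : nat)
    (A : 'M[extnum R]_n) :
  nonsingular A ->
  zeroless (max_abs A) ->
  ~ absorber (relative_det A) (max_npart A) ->
  invertible_wrt (max_npart A / max_abs A)%X A /\
  inverse_wrt (max_npart A / max_abs A)%X A
    (ext_scalemx (ext_det A)^-1%X (ext_cofactor A)^T).
Proof.
move=> D0 M0 RA; have [m Mm] := extnum_inhabited (max_abs A).
have [a Aa] := choice (fun ij : 'I_n * 'I_n => extnum_inhabited (A ij.1 ij.2)).
suff AB : inverse_wrt (max_npart A / max_abs A)%X A
    (ext_scalemx (ext_det A)^-1%X (ext_cofactor A)^T).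
  by split=> //; eexists; exact: AB.
apply: (adjugate_inverse M0 Mm D0 RA (a := \matrix_(i, j) (a (i, j) / m))) => i j.
by rewrite mxE; apply: (tracks_entry M0 Mm); apply: (Aa (i, j)).
Qed.
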